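(* Let $a,b,d\in\mathbb{R}$ with $b\neq0$ and let $\mu>-1/2$. For every $p\in[1,\infty]$, every $f\in L^p_\mu(\mathbb{R})$ and every $w\in[0,\infty)$, the function $\tau^{a,b,d}_{w,\mu}[f]$ belongs to $L^p_\mu(\mathbb{R})$ and $$\left\|\tau^{a,b,d}_{w,\mu}[f]\right\|_{\mu,p}\leq 4\,\|f\|_{\mu,p}.$$
   Context: For $\mu>-1/2$, $L^p_\mu(\mathbb{R})$ is the space of measurable $f:\mathbb{R}\to\mathbb{C}$ with $\|f\|_{\mu,p}<\infty$, where $\|f\|_{\mu,p}=\left(\int_{\mathbb{R}}|f(v)|^p|v|^{2\mu+1}dv\right)^{1/p}$ for $1\le p<\infty$ and $\|f\|_{\mu,\infty}=\operatorname{ess\,sup}_{v\in\mathbb{R}}|f(v)|$. For nonzero real $x,y$ and real $z$ put $\sigma_{x,y,z}=\frac{x^2+y^2-z^2}{2xy}$. For $w,v,\kappa>0$ put $$K_\mu(w,v,\kappa)=\frac{2^{1-2\mu}\Gamma(\mu+1)}{\sqrt{\pi}\,\Gamma(\mu+1/2)}\,\frac{\left[((w+v)^2-\kappa^2)(\kappa^2-(w-v)^2)\right]^{\mu-1/2}}{(wv\kappa)^{2\mu}}\quad\text{if } |w-v|<\kappa<w+v,$$ and $K_\mu(w,v,\kappa)=0$ otherwise. The Dunkl translation kernel is, for nonzero real $w,v,\kappa$, $$\mathcal{W}_\mu(w,v,\kappa)=\tfrac12\left\{1-\sigma_{w,v,\kappa}+\sigma_{\kappa,w,v}+\sigma_{\kappa,v,w}\right\}K_\mu(|w|,|v|,|\kappa|).$$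 The quadratic-phase Dunkl translation kernel is $\mathcal{W}^{a,b,d}_\mu(w,v,\kappa)=\mathcal{W}_\mu(w,v,\kappa)\,e^{-i[a(w^2+v^2+\kappa^2)+d(w+v+\kappa)]}$, and the quadratic-phase Dunkl translation is, for $w\neq0$ and almost every $v\in\mathbb{R}$, $$\tau^{a,b,d}_{w,\mu}[f](v)=\int_{\mathbb{R}}f(\kappa)\,\mathcal{W}^{a,b,d}_\mu(w,v,\kappa)\,e^{i(a\kappa^2+d\kappa)}\,|\kappa|^{2\mu+1}\,d\kappa,$$ while for $w=0$ one sets $\tau^{a,b,d}_{0,\mu}[f]=f$. *)

(* Defs.v *)
From HB Require Import structures.
From mathcomp Require Import all_boot all_order all_algebra.
From mathcomp Require Import all_classical all_reals all_analysis.
From mathcomp Require Import ess_sup_inf complex.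

Set Implicit Arguments.
Unset Strict Implicit.
Unset Printing Implicit Defensive.

Import Order.TTheory GRing.Theory Num.Theory.
Import numFieldNormedType.Exports.

Local Open Scope classical_set_scope.
Local Open Scope ring_scope.
Local Open Scope complex_scope.

(* [R] equipped with the sigma-algebra of Lebesgue measurable sets, in contrast
   with the canonical structure on [R], which is that of Borel sets. *)
Definition lebesgueR (R : realType) : Type := R.

HB.instance Definition _ (R : realType) := Measurable.copy (lebesgueR R)
  (caratheodory_type (mu_ext (@wlength R idfun))).

Definition leb {R : realType} : set (lebesgueR R) -> \bar R :=
  @completed_lebesgue_measure R.

HB.instance Definition _ (R : realType) := Measure.on (@leb R).
HB.instance Definition _ (R : realType) := SigmaFiniteMeasure.on (@leb R).

Section Complex.
Variable R : realType.

(* [ `|z| ] lives in [R[i]]; this is the modulus as an element of [R]. *)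
Definition cmod (z : R[i]) : R := ComplexField.Normc.normc z.

Definition expi (t : R) : R[i] := cos t +i* sin t.

Definition cmeasurable (f : R -> R[i]) : Prop :=
  measurable_fun [set: lebesgueR R] (fun v : lebesgueR R => complex.Re (f v)) /\
  measurable_fun [set: lebesgueR R] (fun v : lebesgueR R => complex.Im (f v)).

Definition cintegrable (f : R -> R[i]) : Prop :=
  leb.-integrable [set: lebesgueR R] (fun v => (complex.Re (f v))%:E) /\
  leb.-integrable [set: lebesgueR R] (fun v => (complex.Im (f v))%:E).

(* Meaningful when [cintegrable f]. *)
Definition cintegral (f : R -> R[i]) : R[i] :=
  (\int[leb]_v complex.Re (f v)) +i*
  (\int[leb]_v complex.Im (f v)).

End Complex.

Section WeightedLp.
Variable R : realType.
Implicit Types (mu : R) (p : \bar R) (f : R -> R[i]).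

(* Only used for [1 <= p <= +oo]; the value at [p = -oo] is irrelevant. *)
Definition normLp mu p f : \bar R :=
  match p with
  | r%:E => ((\int[leb]_v
               (cmod (f v) `^ r * `|v : R| `^ (2 * mu + 1))%:E) `^ r^-1)%E
  | +oo%E => ess_sup leb (fun v => (cmod (f v))%:E)
  | -oo%E => 0%E
  end.

Definition inLp mu p f : Prop := cmeasurable f /\ (normLp mu p f < +oo)%E.

End WeightedLp.

Section DunklTranslation.
Variable R : realType.
Implicit Types (a b d mu w v k : R) (f : R -> R[i]).

(* Euler's Gamma function on the positive reals. *)
Definition Gamma (x : R) : R :=
  \int[lebesgue_measure]_(t in `]0, +oo[) (t `^ (x - 1) * expR (- t)).

Definition sigma (x y z : R) : R := (x ^+ 2 + y ^+ 2 - z ^+ 2) / (2 * x * y).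

Definition bessel_kernel mu w v k : R :=
  if `|w - v| < k < w + v then
    2 `^ (1 - 2 * mu) * Gamma (mu + 1) / (Num.sqrt pi * Gamma (mu + 1 / 2))
    * ((((w + v) ^+ 2 - k ^+ 2) * (k ^+ 2 - (w - v) ^+ 2)) `^ (mu - 1 / 2)
       / (w * v * k) `^ (2 * mu))
  else 0.

(* If one of [w], [v], [k] is zero, the triangle condition in [bessel_kernel]
   fails and the kernel is zero. *)
Definition dunkl_kernel mu w v k : R :=
  1 / 2 * (1 - sigma w v k + sigma k w v + sigma k v w)
  * bessel_kernel mu `|w| `|v| `|k|.

(* The second parameter of the quadratic-phase transform does not occur in the
   kernel; it is kept to match the three-parameter notation. *)
Definition qpd_kernel a b d mu w v k : R[i] :=
  (dunkl_kernel mu w v k)%:C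
  * expi (- (a * (w ^+ 2 + v ^+ 2 + k ^+ 2) + d * (w + v + k))).

Definition qpd_integrand a b d mu w f v k : R[i] :=
  f k * qpd_kernel a b d mu w v k * expi (a * k ^+ 2 + d * k)
  * (`|k| `^ (2 * mu + 1))%:C.

(* For [w != 0] the value at [v] is meaningful when the integrand is integrable;
   otherwise it is a default value. *)
Definition qpd_translation a b d mu w f : R -> R[i] :=
  if w == 0 then f else fun v => cintegral (qpd_integrand a b d mu w f v).

(* The integral defining the translation converges absolutely at almost every
   point. *)
Definition qpd_translation_defined a b d mu w f : Prop :=
  w != 0 -> \forall v \ae (@leb R), cintegrable (qpd_integrand a b d mu w f v).

End DunklTranslation.

(* Main.v *)
From HB Require Import structures.
Require Import Defs.
From mathcomp Require Import all_boot all_order all_algebra.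
From mathcomp Require Import all_classical all_reals all_analysis.
From mathcomp Require Import measurable_realfun ess_sup_inf complex ring lra.

Set Implicit Arguments.
Unset Strict Implicit.
Unset Printing Implicit Defensive.

Import Order.TTheory GRing.Theory Num.Theory.
Import numFieldNormedType.Exports.
Local Open Scope classical_set_scope.
Local Open Scope ring_scope.

(** The translation by [w > 0] is dominated by a positive integral operator
    with a symmetric kernel of mass at most 4, and such an operator has norm at
    most 4 on every weighted Lp space by the Schur test.

    The domination: inside the triangle condition the three [sigma] terms of
    the Dunkl kernel are cosines of a triangle up to sign, so the bracket
    multiplying the Bessel kernel lies between -4 and 4, and the phases have
    modulus 1.  Hence [normr_dunkl_kernel_le], with the majorant twice the
    Bessel kernel of the absolute values.  This majorant is symmetric
    ([bessel_kernel_swap]) because the triangle condition and Heron's formula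
    are, so one mass bound serves in both variables.

    The mass: the Bessel kernel integrates to 1 over [0, +oo[ against its
    weight; only the upper bound [bessel_kernel_mass] is used.  In a triangle with
    sides w, v, k let y be minus the cotangent of the angle opposite to k.  Then
    the weighted kernel becomes a constant times [(1 + y ^ 2) ^ (- (mu + 1))] dy
    ([bessel_kernel_angle]), whatever w and v are.  The integral of this over
    the real line is computed from the Gamma integrals by exchanging the order
    of integration in a Gaussian double integral ([gamma_beta_integral]), and
    the constant is precisely its inverse ([gamma_ratio_mass]).  Folding the
    real line onto the half-line doubles the mass, and the factor 2 of the
    majorant gives 4 ([majorant_mass]).

    The norm bound: for finite exponents it is [schur_test], that is, Hoelder's
    inequality in one variable followed by Tonelli's theorem; for the exponent
    [+oo] the mass bound suffices.  Finiteness of the bound at almost every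
    point is what makes the integral defining the translation converge there,
    and [cmod_cintegral_le] transfers the bound to the complex integral. *)

(** * The completed and the Borel Lebesgue measure *)

Section Lebesgue.
Variable R : realType.
Local Notation lam := (@lebesgue_measure R).
Local Open Scope ereal_scope.

Lemma measurable_borel_of_lebesgue :
  measurable_fun [set: lebesgueR R] (id : lebesgueR R -> measurableTypeR R).
Proof. by move=> _ A mA; rewrite setTI; exact: sub_caratheodory. Qed.

(** Both measures agree on Borel sets.  Explicit integrals are computed for the
    Borel measure, where the change of variables theorems live. *)
Lemma ge0_integral_leb (f : R -> \bar R) :
  measurable_fun [set: R] f -> (forall x, 0 <= f x) ->
  \int[@leb R]_x f x = \int[lam]_x f x.
Proof.
move=> mf f0.
have := @ge0_integral_pushforward _ _ (lebesgueR R) (measurableTypeR R) R id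
  measurable_borel_of_lebesgue (@leb R) setT f measurableT mf (fun y _ => f0 y).
rewrite preimage_setT => /= <-.
by apply: (@eq_measure_integral _ _ _ setT _ lam f).
Qed.

(** By uniqueness of Lebesgue measure.  The Gamma density may blow up at 0, so
    the scaling is needed for measurable and not only for continuous functions. *)
Lemma ge0_integral_scale (c : R) (f : R -> \bar R) : (0 < c)%R ->
  measurable_fun [set: R] f -> (forall x, 0 <= f x) ->
  \int[lam]_x f x = c%:E * \int[lam]_x f (c * x)%R.
Proof.
move=> c0 mf f0.
pose phi (x : measurableTypeR R) : measurableTypeR R := (c * x)%R.
have mphi : measurable_fun setT phi by exact: mulrl_measurable.
pose m' : {measure set (measurableTypeR R) -> \bar R} :=
  mscale (NngNum (ltW c0)) (pushforward lam phi).
pose m := m' mphi.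
have mE A : measurable A -> lam A = m A.
  apply: lebesgue_measure_unique => // _ [[a b] _ <-].
  change (lam `]a, b] = c%:E * lam (phi @^-1` `]a, b])).
  have -> : phi @^-1` `]a, b] = `](c^-1 * a)%R, (c^-1 * b)%R]%classic.
    by apply/seteqP; split => x /=; rewrite /phi !in_itv/= ltr_pdivrMl//
      ler_pdivlMl.
  rewrite !lebesgue_measure_itv/= !lte_fin ltr_pM2l ?invr_gt0//.
  case: ifP => _; last by rewrite mule0.
  by rewrite -!EFinB -EFinM -mulrBr mulrA divff ?gt_eqF// mul1r.
rewrite (@eq_measure_integral _ _ _ setT m lam f); last by move=> A mA _; exact: mE.
rewrite /m ge0_integral_mscale//=; congr (_ * _).
by rewrite ge0_integral_pushforward.
Qed.

Lemma ge0_integral_lebesgueN (f : R -> \bar R) :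
  measurable_fun [set: R] f -> (forall x, 0 <= f x) ->
  \int[lam]_x f (- x)%R = \int[lam]_x f x.
Proof.
move=> mf f0.
have mN : measurable_fun setT (-%R : measurableTypeR R -> measurableTypeR R).
  exact: oppr_measurable.
pose m' : {measure set (measurableTypeR R) -> \bar R} :=
  pushforward lam (-%R : measurableTypeR R -> measurableTypeR R).
rewrite [RHS](@eq_measure_integral _ _ _ setT (m' mN) lam f).
  by rewrite /m' ge0_integral_pushforward.
by move=> A mA _; apply/esym; exact: lebesgue_measureN.
Qed.
End Lebesgue.

(** * A Gamma and Beta identity *)

Section GammaBeta.
Variable R : realType.
Local Notation lam := (@lebesgue_measure R).

(** The integrand of [Gamma] is extended by 0 so that Tonelli's theorem applies
    on the whole plane. *)
Definition gamma_density (s t : R) : R :=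
  if 0 < t then t `^ (s - 1) * expR (- t) else 0.

Lemma gamma_density_ge0 s t : 0 <= gamma_density s t.
Proof.
rewrite /gamma_density; case: ifP => // _.
by rewrite mulr_ge0// ?powR_ge0 ?expR_ge0.
Qed.

Lemma measurable_gamma_density s : measurable_fun [set: R] (gamma_density s).
Proof.
apply: measurable_fun_ifT => //; first exact: measurable_fun_ltr.
by apply: measurable_funM => //; apply: measurableT_comp => //.
Qed.

Lemma GammaE (s : R) : Gamma s = fine (\int[lam]_t (gamma_density s t)%:E).
Proof.
rewrite /Gamma /Rintegral integral_mkcond; congr fine.
apply: eq_integral => t _; rewrite patchE /gamma_density mem_setE in_itv/= andbT.
by case: ifP.
Qed.

Local Open Scope ereal_scope.

Lemma gauss_integral_scale (t : R) : (0 < t)%R ->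
  (Num.sqrt pi)%:E =
  (t `^ (1 / 2))%:E * \int[lam]_y (expR (- (t * y ^+ 2)))%:E.
Proof.
move=> t0; rewrite -integralT_gauss (@ge0_integral_scale _ (t `^ (1 / 2))).
- congr (_ * _); apply: eq_integral => y _; rewrite /gauss_fun.
  have tE : ((t `^ (1 / 2)) ^+ 2 = t)%R.
    by rewrite -powR_mulrn ?powR_ge0// -powRrM mul1r mulVf// powRr1// ltW.
  by rewrite exprMn tE.
- exact: powR_gt0.
- by apply/measurable_EFinP; exact: measurable_gauss_fun.
- by move=> y; rewrite lee_fin gauss_fun_ge0.
Qed.

Lemma gamma_integral_scale (s c : R) : (0 < c)%R ->
  \int[lam]_t (gamma_density s t * expR (- (t * (c - 1))))%:E =
  (c `^ (- s))%:E * \int[lam]_t (gamma_density s t)%:E.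
Proof.
move=> c0; rewrite [in RHS](@ge0_integral_scale _ c)//; last 2 first.
- by apply/measurable_EFinP; exact: measurable_gamma_density.
- by move=> y; rewrite lee_fin gamma_density_ge0.
rewrite muleA -EFinM -ge0_integralZl//; last 3 first.
- apply/measurable_EFinP; apply: (measurableT_comp (measurable_gamma_density s)).
  exact: mulrl_measurable.
- by move=> y _; rewrite lee_fin gamma_density_ge0.
- by rewrite lee_fin mulr_ge0 ?powR_ge0// ltW.
apply: eq_integral => t _; rewrite -EFinM; congr EFin.
rewrite /gamma_density pmulr_rgt0//; case: ifPn => [t0|]; last by rewrite mul0r mulr0.
have -> : (c `^ (- s) * c = c `^ (1 - s))%R.
  by rewrite -[X in (_ * X)%R]powRr1 ?ltW// -powRD ?(gt_eqF c0) ?implybT// addrC.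
rewrite powRM ?ltW// !mulrA -powRD; last by rewrite (gt_eqF c0) implybT.
have -> : (1 - s + (s - 1) = 0)%R by ring.
rewrite powRr0 mul1r -mulrA -expRD; congr (_ * expR _)%R; ring.
Qed.

(** The identity [Gamma s * Gamma (1 / 2) = Gamma (s + 1 / 2) * B(s, 1 / 2)] with
    the Beta function as an integral over the line.  For each t the factor
    [Num.sqrt pi] is [t `^ (1 / 2)] times a Gaussian integral in y; exchanging
    the two integrals leaves, for each y, a Gamma integral scaled by
    [1 + y ^+ 2].  Extended reals spare any discussion of convergence. *)
Lemma gamma_beta_integral (s : R) :
  \int[lam]_t (gamma_density s t)%:E * (Num.sqrt pi)%:E =
  \int[lam]_t (gamma_density (s + 1 / 2) t)%:E *
  \int[lam]_y ((1 + y ^+ 2) `^ (- (s + 1 / 2)))%:E.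
Proof.
pose F (z : R * R) := 
  (gamma_density (s + 1 / 2) z.1 * expR (- (z.1 * z.2 ^+ 2)))%:E.
have mF : measurable_fun setT F.
  apply/measurable_EFinP; apply: measurable_funM.
    exact: (measurableT_comp (measurable_gamma_density _)).
  apply: measurableT_comp => //; apply: measurableT_comp => //.
  by apply: measurable_funM => //; exact: measurable_funX.
have F0 z : 0 <= F z by rewrite lee_fin mulr_ge0 ?gamma_density_ge0 ?expR_ge0.
transitivity (\int[lam]_t \int[lam]_y F (t, y)).
  rewrite -ge0_integralZr//; last 2 first.
  - by apply/measurable_EFinP; exact: measurable_gamma_density.
  - by move=> y _; rewrite lee_fin gamma_density_ge0.
  apply: eq_integral => t _; rewrite /F /=.
  under eq_integral do rewrite EFinM.
  rewrite ge0_integralZl//; last 2 first.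
  - apply/measurable_EFinP; apply: measurableT_comp => //.
    by apply: measurableT_comp => //; apply: measurable_funM.
  - by rewrite lee_fin gamma_density_ge0.
  rewrite /gamma_density; case: ifPn => [t0|]; last by rewrite !mul0e.
  rewrite (gauss_integral_scale t0) muleA -EFinM; congr (_%:E * _).
  rewrite mulrAC -powRD; last by rewrite (gt_eqF t0) implybT.
  by congr (_ `^ _ * _)%R; ring.
rewrite fubini_tonelli//.
rewrite -ge0_integralZl//; last 3 first.
- apply/measurable_EFinP; apply: (measurableT_comp (measurable_powR _)).
  by apply: measurable_funD => //; exact: measurable_funX.
- by move=> y _; rewrite lee_fin powR_ge0.
- by apply: integral_ge0 => t _; rewrite lee_fin gamma_density_ge0.
apply: eq_integral => y _; rewrite /F /= muleC -gamma_integral_scale.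
  by apply: eq_integral => t _; congr (_ * expR (- (_ * _)))%:E; ring.
by rewrite ltr_wpDr// sqr_ge0.
Qed.
End GammaBeta.

(** * An inequality for changes of variables on an open interval *)

Section Substitution.
Variable R : realType.
Local Notation lam := (@lebesgue_measure R).

(** The substitution theorem gives the integral of [G] over [[F a, F b]], which is
    only a part of the line. *)
Lemma integral_substitution_le_cc (F dF G : R -> R) (a b : R) : a <= b ->
  {in `[a, b], forall x : R, is_derive x 1 F (dF x)} ->
  {in `[a, b], continuous dF} ->
  {in `[a, b], forall x, 0 < dF x} ->
  continuous G -> (forall y, 0 <= G y) ->
  (\int[lam]_(x in `[a, b]) (G (F x) * dF x)%:E <= \int[lam]_y (G y)%:E)%E.
Proof.
move=> ab Fd cdF dF0 cG G0.
have oc x : x \in `]a, b[ -> x \in `[a, b] by exact: subset_itv_oo_cc.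
have dFE : {in `[a, b], forall x, derive1 F x = dF x}.
  by move=> x /Fd Fx; rewrite derive1E; exact: derive_val.
have Fdrv : {in `[a, b], forall x, derivable F x 1}.
  by move=> x /Fd Fx; exact: ex_derive.
have Fcont : {in `[a, b], continuous F}.
  move=> x /Fdrv Fx.
  by apply: differentiable_continuous; exact/derivable1_diffP.
have [->|] := eqVneq a b.
  by rewrite set_itv1 integral_set1 integral_ge0// => y _; rewrite lee_fin.
rewrite neq_lt => /orP[{}ab|]; last by rewrite ltNge ab.
have aab : a \in `[a, b] by rewrite in_itv/= lexx ltW.
have bab : b \in `[a, b] by rewrite in_itv/= lexx ltW.
have cF' x : x \in `]a, b[ -> derive1 F y @[y --> x] --> dF x.
  move=> xab; apply: cvg_trans (cdF x (oc _ xab)).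
  apply: near_eq_cvg; near=> y; rewrite dFE//; apply: oc.
  by near: y; exact: near_in_itvoo.
rewrite (_ : \int[lam]_(x in _) _ =
  \int[lam]_(x in `[a, b]) ((((G \o F) * derive1 F) x)%R)%:E)%E; last first.
  by apply: eq_integral => x; rewrite inE/= => xab; rewrite fctE dFE.
rewrite -integration_by_substitution_increasing//.
- apply: ge0_subset_integral => //.
  + by apply/measurable_EFinP; exact: continuous_measurable_fun.
  + by move=> y _; rewrite lee_fin.
- exact: ltW.
- apply: gtr0_derive1_lt_cc.
  + by move=> x /oc/Fdrv.
  + by move=> x /oc xab; rewrite dFE// dF0.
  + exact: derivable_within_continuous.
- by move=> x xab; rewrite /continuous_at dFE ?oc//; exact: cF'.
- apply/cvg_ex; exists (dF a).
  apply: cvg_trans (cvg_at_right_filter (cdF a aab)).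
  apply: near_eq_cvg; near=> y; rewrite dFE// in_itv/=; apply/andP; split => //.
  by near: y; exact: nbhs_right_le.
- apply/cvg_ex; exists (dF b).
  apply: cvg_trans (cvg_at_left_filter (cdF b bab)).
  apply: near_eq_cvg; near=> y; rewrite dFE// in_itv/=; apply/andP; split => //.
  by near: y; exact: nbhs_left_ge.
- split.
  + by move=> x /oc/Fdrv.
  + exact: cvg_at_right_filter (Fcont a aab).
  + exact: cvg_at_left_filter (Fcont b bab).
- exact: continuous_subspaceT.
Unshelve. all: by end_near. Qed.

Lemma itvoo_bigcup_itvcc (a b : R) : a < b ->
  let e := (fun n : nat => (b - a) / 2 / n.+1%:R) in
  `]a, b[%classic = \bigcup_n `[a + e n, b - e n]%classic.
Proof.
move=> ab e; have ba0 : 0 < (b - a) / 2 by rewrite divr_gt0// subr_gt0.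
apply/seteqP; split => [x /=|x [n _] /=]; rewrite !in_itv/= => /andP[ax xb].
  have m0 : 0 < Num.min (x - a) (b - x) by rewrite lt_min !subr_gt0 ax.
  have [n _ nE] := near_infty_natSinv_lt (PosNum (divr_gt0 m0 ba0)).
  exists n => //=; rewrite in_itv/=.
  have : e n <= Num.min (x - a) (b - x).
    by rewrite /e mulrC -ler_pdivlMr// ltW//; exact: nE (leqnn n).
  by rewrite le_min => /andP[ea eb]; apply/andP; split; lra.
have e0 : 0 < e n by rewrite divr_gt0.
by apply/andP; split; [apply: lt_le_trans ax|apply: le_lt_trans xb _];
  rewrite ?ltrDl// ltrBlDr ltrDl.
Qed.

(** [dF] may be unbounded at both ends, as it is for the cotangent of an angle of
    a degenerating triangle; compact subintervals exhaust the open one. *)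
Lemma integral_substitution_le_oo (F dF G : R -> R) (a b : R) : a < b ->
  measurable_fun setT F -> measurable_fun setT dF ->
  {in `]a, b[, forall x : R, is_derive x 1 F (dF x)} ->
  {in `]a, b[, continuous dF} ->
  {in `]a, b[, forall x, 0 < dF x} ->
  continuous G -> (forall y, 0 <= G y) ->
  (\int[lam]_(x in `]a, b[) (G (F x) * dF x)%:E <= \int[lam]_y (G y)%:E)%E.
Proof.
move=> ab mF mdF Fd cdF dF0 cG G0.
have ba0 : 0 < (b - a) / 2 by rewrite divr_gt0// subr_gt0.
rewrite (itvoo_bigcup_itvcc ab).
set e := fun n : nat => (b - a) / 2 / n.+1%:R.
have sub n : `[a + e n, b - e n]%classic `<=` `]a, b[%classic.
  by move=> x xn; rewrite (itvoo_bigcup_itvcc ab); exists n.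
have ndF : nondecreasing_seq (fun n => `[a + e n, b - e n]%classic : set R).
  move=> m n mn; apply/subsetPset => x /=; rewrite !in_itv/=.
  have emn : e n <= e m by rewrite ler_pM2l// lef_pV2 ?posrE// ler_nat.
  by move=> /andP[ax xb]; apply/andP; split;
    [apply: le_trans ax|apply: le_trans xb _]; rewrite ?lerD2l// lerN2.
pose I n : set R := `[a + e n, b - e n]%classic.
have cvgI : (\int[lam]_(x in I n) (G (F x) * dF x)%:E
      @[n --> \oo] --> \int[lam]_(x in \bigcup_n I n)
                     (G (F x) * dF x)%:E)%E.
  apply: (@ge0_nondecreasing_set_cvg_integral _ (measurableTypeR R)) => //.
  - by move=> n; exact: measurable_itv.
  - move=> n; apply: measurable_funTS; apply/measurable_EFinP.
    apply: measurable_funM => //; apply: measurableT_comp => //.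
    exact: continuous_measurable_fun.
  - by move=> n x /sub xab; rewrite lee_fin mulr_ge0// ltW// dF0.
rewrite -(cvg_lim _ cvgI)//.
apply: lime_le; first by apply/cvg_ex; eexists; exact: cvgI.
near=> n; rewrite /I.
have [abn|abn] := leP (a + e n) (b - e n); last first.
  rewrite set_itv_ge; last by rewrite bnd_simp -ltNge.
  by rewrite integral_set0 integral_ge0// => y _; rewrite lee_fin.
by apply: integral_substitution_le_cc => //; move=> x /sub;
  [exact: Fd|exact: cdF|exact: dF0].
Unshelve. all: by end_near. Qed.

End Substitution.

(** * Triangles and the cotangent coordinate *)

Section KernelMass.
Variable R : realType.
Local Notation lam := (@lebesgue_measure R).
Implicit Types mu w v k : R.

(** Sixteen times the squared area of the triangle with sides x, y, z. *)
Definition heron (x y z : R) : R := ((x + y) ^+ 2 - z ^+ 2) * (z ^+ 2 - (x - y) ^+ 2).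

Lemma triangle_swap w v k : (`|w - v| < k < w + v) = (`|w - k| < v < w + k).
Proof. by apply/idP/idP => /andP[]; rewrite !ltr_norml => /andP[? ?] ?;
  apply/andP; (split; [apply/andP; split|]); lra. Qed.

Lemma heron_swap w v k : heron w v k = heron w k v.
Proof. by rewrite /heron; ring. Qed.

Lemma heron_gt0 w v k : `|w - v| < k < w + v -> 0 < heron w v k.
Proof.
move=> /andP[+ kwv]; rewrite ltr_norml => /andP[k1 k2].
have -> : heron w v k = (w + v - k) * (w + v + k) * ((k - (w - v)) * (k + (w - v))).
  by rewrite /heron; ring.
by rewrite !mulr_gt0//; lra.
Qed.

(** By the law of cosines, minus the cotangent of the angle between the sides w
    and v: its cosine is [(w ^+ 2 + v ^+ 2 - k ^+ 2) / (2 * w * v)] and its sine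
    is the square root of [heron w v k] over [2 * w * v].  The sign makes it
    increasing in k. *)
Definition angle_cot w v k : R :=
  (k ^+ 2 - w ^+ 2 - v ^+ 2) * heron w v k `^ (- (1 / 2)).

Definition angle_cot' w v k : R :=
  8 * k * (w * v) ^+ 2 * heron w v k `^ (- (3 / 2)).

(** One plus the squared cotangent is the inverse squared sine. *)
Lemma angle_cot_sqr w v k : `|w - v| < k < w + v ->
  1 + angle_cot w v k ^+ 2 = 4 * (w * v) ^+ 2 / heron w v k.
Proof.
move=> /heron_gt0 h0.
have hE : (heron w v k `^ (- (1 / 2))) ^+ 2 = (heron w v k)^-1.
  rewrite -powR_mulrn ?powR_ge0// -powRrM (_ : - (1 / 2) * 2%:R = -1 :> R).
    by rewrite powR_inv1// ltW.
  by field.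
rewrite /angle_cot exprMn hE; apply: (@mulIf _ (heron w v k)); first by rewrite gt_eqF.
rewrite mulrDl mul1r !mulfVK ?gt_eqF// /heron; ring.
Qed.

Lemma is_derive_angle_cot w v k : `|w - v| < k < w + v ->
  is_derive k 1 (angle_cot w v) (angle_cot' w v k).
Proof.
move=> /heron_gt0 h0.
pose q (k : R) : R := k ^+ 2 - w ^+ 2 - v ^+ 2.
have dq : is_derive k 1 q (2 * k).
  rewrite /q; apply: is_derive_eq; rewrite /GRing.scale /=; ring.
have dh : is_derive k 1 (heron w v) (- 4 * q k * k).
  rewrite /heron; apply: is_derive_eq; rewrite /GRing.scale /= /q; ring.
have dp : is_derive k 1 ((@powR R ^~ (- (1 / 2))) \o heron w v)
    (- (1 / 2) * heron w v k `^ (- (1 / 2) - 1) * (- 4 * q k * k)).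
  by apply: is_derive1_comp; exact: is_derive1_powR.
have -> : angle_cot w v = q * ((@powR R ^~ (- (1 / 2))) \o heron w v) by [].
apply: (is_derive_eq (is_deriveM dq dp)).
rewrite /GRing.scale /= /angle_cot' /q.
have -> : - (1 / 2) - 1 = - (3 / 2) :> R by field.
have -> : heron w v k `^ (- (1 / 2)) = heron w v k * heron w v k `^ (- (3 / 2)).
  rewrite -[X in _ = X * _]powRr1 ?ltW// -powRD ?(gt_eqF h0) ?implybT//.
  by congr (_ `^ _); field.
by rewrite [X in X * _ `^ _]/heron; field.
Qed.

Lemma measurable_heron w v : measurable_fun [set: R] (heron w v).
Proof.
by apply: measurable_funM; apply: measurable_funB => //; exact: measurable_funX.
Qed.

Lemma measurable_angle_cot w v : measurable_fun [set: R] (angle_cot w v).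
Proof.
apply: measurable_funM.
  by do 2 apply: measurable_funB => //; exact: measurable_funX.
exact: (measurableT_comp (measurable_powR _) (measurable_heron w v)).
Qed.

Lemma measurable_angle_cot' w v : measurable_fun [set: R] (angle_cot' w v).
Proof.
apply: measurable_funM; first by do 2 apply: measurable_funM => //.
exact: (measurableT_comp (measurable_powR _) (measurable_heron w v)).
Qed.

Definition gamma_ratio mu : R :=
  Gamma (mu + 1) / (Num.sqrt pi * Gamma (mu + 1 / 2)).

(** The cotangent absorbs all dependence on w and v: what remains is a fixed
    function of it times its derivative in k. *)
Lemma bessel_kernel_angle mu w v k : 0 < w -> 0 < v ->
  `|w - v| < k < w + v ->
  bessel_kernel mu w v k * `|k| `^ (2 * mu + 1) =
  gamma_ratio mu * (1 + angle_cot w v k ^+ 2) `^ (- (mu + 1)) * angle_cot' w v k.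
Proof.
move=> w0 v0 tri; have h0 := heron_gt0 tri.
have k0 : 0 < k by case/andP: tri => wvk _; exact: le_lt_trans wvk.
have wv0 : 0 < w * v by rewrite mulr_gt0.
have p0 : 0 < 4 * (w * v) ^+ 2 / heron w v k by rewrite divr_gt0// mulr_gt0// exprn_gt0.
have L : ln (4 * (w * v) ^+ 2 / heron w v k) =
    2 * ln 2 + 2 * (ln w + ln v) - ln (heron w v k).
  rewrite lnM ?posrE ?invr_gt0// ?lnV ?posrE// ?mulr_gt0 ?exprn_gt0//.
  rewrite lnM ?posrE ?exprn_gt0// lnXn// lnM ?posrE//.
  rewrite (_ : 4 = 2 ^+ 2 :> R); last by ring.
  by rewrite lnXn// !mulr_natl.
have key : 2 `^ (1 - 2 * mu) * (heron w v k `^ (mu - 1 / 2) / (w * v * k) `^ (2 * mu)) *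
    k `^ (2 * mu + 1) =
  (4 * (w * v) ^+ 2 / heron w v k) `^ (- (mu + 1)) * angle_cot' w v k.
  (* Both sides are positive monomials in 2, w, v, k and D: compare logarithms. *)
  rewrite /angle_cot'; move: (heron w v k) h0 p0 L => D h0 p0 L.
  have wvk0 : 0 < w * v * k by rewrite mulr_gt0.
  apply: ln_inj; rewrite ?posrE.
  - by rewrite !(mulr_gt0, powR_gt0, invr_gt0).
  - by rewrite !(mulr_gt0, powR_gt0, invr_gt0, exprn_gt0).
  have -> : 8 = 2 ^+ 3 :> R by ring.
  rewrite !lnM ?posrE ?(mulr_gt0, powR_gt0, invr_gt0, exprn_gt0)//.
  rewrite lnV ?posrE ?powR_gt0// !ln_powR L !lnM ?posrE//.
  by field.
rewrite /bessel_kernel tri -/(heron w v k) angle_cot_sqr// gtr0_norm//.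
by rewrite -[RHS]mulrA -key /gamma_ratio; ring.
Qed.

End KernelMass.

(** * Total mass of the kernel *)

Section BesselMass.
Variable R : realType.
Local Notation lam := (@lebesgue_measure R).
Implicit Types mu w v k : R.

Lemma Gamma_ge0 (s : R) : 0 <= Gamma s.
Proof.
by rewrite GammaE fine_ge0// integral_ge0// => t _; rewrite lee_fin gamma_density_ge0.
Qed.

Lemma gamma_ratio_ge0 mu : 0 <= gamma_ratio mu.
Proof. by rewrite /gamma_ratio divr_ge0 ?mulr_ge0 ?Gamma_ge0 ?sqrtr_ge0. Qed.

(** If one of the two Gamma integrals is infinite, [fine] reads it as 0 and the
    ratio vanishes; otherwise this is [gamma_beta_integral]. *)
Lemma gamma_ratio_mass mu :
  ((gamma_ratio mu)%:E * \int[lam]_y ((1 + y ^+ 2) `^ (- (mu + 1)))%:E <= 1)%E.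
Proof.
have := gamma_beta_integral (mu + 1 / 2).
have -> : mu + 1 / 2 + 1 / 2 = mu + 1 by field.
rewrite /gamma_ratio !GammaE.
have : (0 <= \int[lam]_t (gamma_density (mu + 1 / 2) t)%:E)%E.
  by apply: integral_ge0 => t _; rewrite lee_fin gamma_density_ge0.
have : (0 <= \int[lam]_t (gamma_density (mu + 1) t)%:E)%E.
  by apply: integral_ge0 => t _; rewrite lee_fin gamma_density_ge0.
have : (0 <= \int[lam]_y ((1 + y ^+ 2) `^ (- (mu + 1)))%:E)%E.
  by apply: integral_ge0 => t _; rewrite lee_fin powR_ge0.
set I := (\int[lam]_y ((1 + y ^+ 2) `^ _)%:E)%E.
move: I (\int[lam]_y (gamma_density (mu + 1) y)%:E)%E.
move: (\int[lam]_y (gamma_density (mu + 1 / 2) y)%:E)%E => A I B.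
have s0 : 0 < Num.sqrt (pi : R) by rewrite sqrtr_gt0 pi_gt0.
(* [fine +oo = 0] makes the ratio vanish in the infinite cases. *)
have [A_fin|] := boolP (A \is a fin_num); last first.
  by case: A => //= _ _ _ _ _; rewrite mulr0 invr0 mulr0 mul0e.
have [B_fin|] := boolP (B \is a fin_num); last first.
  by case: B => //= _ _ _ _ _; rewrite mul0r mul0e.
case: A A_fin => [a| |]// _; case: B B_fin => [b| |]// _ I0.
rewrite !lee_fin /= => b0 a0 abI.
have [->|a_neq0] := eqVneq a 0; first by rewrite mulr0 invr0 mulr0 mul0e.
have [->|b_neq0] := eqVneq b 0; first by rewrite mul0r mul0e.
have bp : 0 < b by rewrite lt0r b_neq0.
have ap : 0 < a by rewrite lt0r a_neq0.
(* With a and b positive, the identity forces the integral I to be finite. *)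
case: I I0 abI => [r| |]//= r0; last by rewrite gt0_muley ?lte_fin.
rewrite -!EFinM => -[E]; rewrite lee_fin mulrAC -E.
by rewrite ler_pdivrMr ?mulr_gt0// mul1r mulrC.
Qed.

Lemma bessel_kernel_ge0 mu w v k : 0 <= bessel_kernel mu w v k.
Proof.
rewrite /bessel_kernel; case: ifP => // _.
by rewrite mulr_ge0// divr_ge0 ?mulr_ge0 ?powR_ge0 ?sqrtr_ge0 ?Gamma_ge0.
Qed.

Lemma bessel_kernel_swap mu w v k : bessel_kernel mu w v k = bessel_kernel mu w k v.
Proof.
rewrite /bessel_kernel triangle_swap -/(heron w v k) heron_swap.
by case: ifP => // _; rewrite [w * v * k]mulrAC.
Qed.

(** The inverse is written as [x * (x ^+ 2) `^ (-1)], which is also right at 0,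
    where the convention is that the inverse of 0 is 0. *)
Lemma measurable_funV d (T : measurableType d) (f : T -> R) :
  measurable_fun setT f -> measurable_fun setT (fun t => (f t)^-1).
Proof.
move=> mf.
have -> : (fun t => (f t)^-1) = (fun t => f t * (f t ^+ 2) `^ (-1)).
  apply/funext => t; have [->|f0] := eqVneq (f t) 0; first by rewrite invr0 mul0r.
  by rewrite powR_inv1 ?sqr_ge0//; field.
apply: measurable_funM => //; apply: (measurableT_comp (measurable_powR _)).
exact: measurable_funX.
Qed.

Lemma measurable_bessel_kernel mu d (T : measurableType d) (f g h : T -> R) :
  measurable_fun setT f -> measurable_fun setT g -> measurable_fun setT h ->
  measurable_fun setT (fun t => bessel_kernel mu (f t) (g t) (h t)).
Proof.
move=> mf mg mh; apply: measurable_fun_ifT => //.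
  apply: measurable_and; apply: measurable_fun_ltr => //.
  - by apply: measurableT_comp => //; exact: measurable_funB.
  - exact: measurable_funD.
apply: measurable_funM => //; apply: measurable_funM.
  apply: (measurableT_comp (measurable_powR _)).
  by apply: measurable_funM; apply: measurable_funB; apply: measurable_funX => //;
    [exact: measurable_funD|exact: measurable_funB].
apply: measurable_funV; apply: (measurableT_comp (measurable_powR _)).
by do 2 apply: measurable_funM => //.
Qed.

(** The constant of the kernel is the one that turns the total mass into
    [gamma_ratio_mass]. *)
Lemma bessel_kernel_mass mu w v : 0 < w -> 0 < v ->
  (\int[lam]_k (bessel_kernel mu w v k * `|k| `^ (2 * mu + 1))%:E <= 1)%E.
Proof.
move=> w0 v0.
pose G y : R := gamma_ratio mu * (1 + y ^+ 2) `^ (- (mu + 1)).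
have wv : `|w - v| < w + v by rewrite ltr_norml; apply/andP; split; lra.
have -> : (\int[lam]_k (bessel_kernel mu w v k * `|k| `^ (2 * mu + 1))%:E =
  \int[lam]_(k in `](`|w - v|)%R, (w + v)%R[)
    (G (angle_cot w v k) * angle_cot' w v k)%:E)%E.
  rewrite [RHS]integral_mkcond; apply: eq_integral => k _.
  rewrite patchE mem_setE in_itv/=; case: ifPn => tri.
    by rewrite bessel_kernel_angle.
  by rewrite /bessel_kernel (negbTE tri) mul0r.
have cG : continuous G.
  move=> y; apply: cvgM; first exact: cvg_cst.
  apply: (@continuous_comp _ _ _ (fun y : R => 1 + y ^+ 2) (@powR R ^~ (- (mu + 1)))).
    by apply: cvgD; [exact: cvg_cst|exact: exprn_continuous].
  apply: differentiable_continuous; apply/derivable1_diffP.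
  by apply: derivable_powR; rewrite in_itv/= andbT ltr_wpDr// sqr_ge0.
have G0 y : 0 <= G y by rewrite mulr_ge0 ?gamma_ratio_ge0 ?powR_ge0.
apply: le_trans (integral_substitution_le_oo wv _ _ _ _ _ cG G0) _.
- exact: measurable_angle_cot.
- exact: measurable_angle_cot'.
- by move=> k; rewrite in_itv/= => /is_derive_angle_cot.
- move=> k; rewrite in_itv/= => /heron_gt0 h0.
  apply: cvgM.
    apply: cvgM; last exact: cvg_cst.
    by apply: cvgM; [exact: cvg_cst|exact: cvg_id].
  apply: (@continuous_comp _ _ _ (heron w v) (@powR R ^~ (- (3 / 2)))).
    by apply: cvgM; apply: cvgB => //; do ?[exact: cvg_cst|exact: exprn_continuous].
  apply: differentiable_continuous; apply/derivable1_diffP.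
  by apply: derivable_powR; rewrite in_itv/= andbT.
- move=> k; rewrite in_itv/= => tri; have h0 := heron_gt0 tri.
  have k0 : 0 < k by case/andP: tri => wvk _; exact: le_lt_trans wvk.
  by rewrite /angle_cot' mulr_gt0 ?powR_gt0// mulr_gt0 ?exprn_gt0 ?mulr_gt0.
- under eq_integral do rewrite EFinM.
  rewrite ge0_integralZl//; first exact: gamma_ratio_mass.
  + apply/measurable_EFinP; apply: (measurableT_comp (measurable_powR _)).
    by apply: measurable_funD => //; exact: measurable_funX.
  + by move=> y _; rewrite lee_fin powR_ge0.
  + by rewrite lee_fin gamma_ratio_ge0.
Qed.

Lemma bessel_kernel_le0 mu w v k : k <= 0 -> bessel_kernel mu w v k = 0.
Proof.
move=> k0; rewrite /bessel_kernel; case: ifP => // /andP[wvk _].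
by have := le_lt_trans (normr_ge0 _) wvk; rewrite ltNge k0.
Qed.

(** The two half-lines contribute equally. *)
Lemma bessel_kernel_mass_abs mu w v : 0 < w -> 0 < v ->
  (\int[lam]_k (bessel_kernel mu w v `|k| * `|k| `^ (2 * mu + 1))%:E <= 2%:E)%E.
Proof.
move=> w0 v0; pose h k : R := bessel_kernel mu w v k * `|k| `^ (2 * mu + 1).
have h0 k : 0 <= h k by rewrite mulr_ge0 ?bessel_kernel_ge0 ?powR_ge0.
have mh : measurable_fun [set: R] h.
  apply: measurable_funM.
    by apply: measurable_bessel_kernel => //; exact: measurable_cst.
  by apply: (measurableT_comp (measurable_powR _)); exact: normr_measurable.
have mhN : measurable_fun [set: R] (h \o -%R).
  by apply: (measurableT_comp mh); exact: oppr_measurable.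
have -> : (\int[lam]_k (bessel_kernel mu w v `|k| * `|k| `^ (2 * mu + 1))%:E =
    \int[lam]_k ((h k)%:E + (h (- k))%:E))%E.
  apply: eq_integral => k _; rewrite -EFinD /h normrN; congr EFin.
  have [k0|k0] := ltP 0 k.
    by rewrite gtr0_norm// [X in _ + X * _]bessel_kernel_le0 ?mul0r ?addr0// oppr_le0 ltW.
  by rewrite ler0_norm// [X in _ = X * _ + _]bessel_kernel_le0// mul0r add0r.
rewrite ge0_integralD//=; first last.
- by apply/measurable_EFinP.
- by move=> k _; rewrite lee_fin.
- by apply/measurable_EFinP.
- by move=> k _; rewrite lee_fin.
have -> : (\int[lam]_k (h (- k))%:E = \int[lam]_k (h k)%:E)%E.
  rewrite -(@ge0_integral_lebesgueN _ (EFin \o h))//.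
  by apply/measurable_EFinP.
by rewrite (_ : 2%:E = 1 + 1)%E// leeD// bessel_kernel_mass.
Qed.
End BesselMass.

(** * The Schur test *)

Lemma poweR_le (R : realType) (r : R) (x y : \bar R) :
  0 <= r -> (0 <= x)%E -> (x <= y)%E -> (x `^ r <= y `^ r)%E.
Proof.
move=> r0 x0 xy; apply: gt0_ler_poweR => //; rewrite in_itv/= leey andbT//.
exact: le_trans xy.
Qed.

Section Schur.
Context d (T : measurableType d) (R : realType).
Local Open Scope ereal_scope.

(** Jensen's inequality for the measure of density n, whose mass is at most C:
    Hoelder's inequality for the factors [g * n `^ r^-1] and [n `^ q^-1]. *)
Lemma integralM_powR_le (m : {measure set T -> \bar R}) (g n : T -> R) (r C : R) :
  (1 <= r)%R -> measurable_fun setT g -> measurable_fun setT n ->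
  (forall t, 0 <= g t)%R -> (forall t, 0 <= n t)%R ->
  \int[m]_t (n t)%:E <= C%:E ->
  (\int[m]_t (g t * n t)%:E) `^ r <=
    (C `^ (r - 1))%:E * \int[m]_t (g t `^ r * n t)%:E.
Proof.
move=> r1 mg mn g0 n0 nC.
have r0 : (0 < r)%R by exact: lt_le_trans r1.
have i0 : 0 <= \int[m]_t (g t `^ r * n t)%:E.
  by apply: integral_ge0 => t _; rewrite lee_fin mulr_ge0// powR_ge0.
have [r_eq1|r_neq1] := eqVneq r 1%R.
  rewrite r_eq1 subrr powRr0 mul1e poweRe1; last first.
    by apply: integral_ge0 => t _; rewrite lee_fin mulr_ge0.
  by under [leRHS]eq_integral do rewrite powRr1//.
have r1' : (1 < r)%R by rewrite lt_neqAle eq_sym r_neq1.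
have rB0 : (r - 1 != 0)%R by rewrite subr_eq0.
pose q := (r / (r - 1))%R.
have q0 : (0 < q)%R by rewrite divr_gt0// subr_gt0.
have rq : (r^-1 + q^-1 = 1)%R.
  rewrite /q invf_div -[X in (X + _)%R]mul1r -mulrDl addrC subrK.
  by rewrite divff// gt_eqF.
pose f1 t := (g t * n t `^ r^-1)%R; pose f2 t := (n t `^ q^-1)%R.
have f10 t : (0 <= f1 t)%R by rewrite mulr_ge0 ?powR_ge0.
have mf1 : measurable_fun setT f1.
  by apply: measurable_funM => //; exact: (measurableT_comp (measurable_powR _)).
have mf2 : measurable_fun setT f2 by exact: (measurableT_comp (measurable_powR _)).
have := hoelder m mf1 mf2 r0 q0 rq.
rewrite Lnorm1.
under eq_integral => t _.
  rewrite /= ger0_norm; last by rewrite mulr_ge0 ?powR_ge0.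
  rewrite /f1 /f2 -mulrA -powRD ?rq ?oner_eq0// powRr1//.
  over.
move=> hold; apply: le_trans (poweR_le (ltW r0) _ hold) _.
  by apply: integral_ge0 => t _; rewrite lee_fin mulr_ge0.
rewrite poweRM ?Lnorm_ge0// muleC.
rewrite poweR_Lnorm ?gt_eqF//.
apply: lee_pmul; rewrite ?poweR_ge0//.
- by apply: integral_ge0 => t _; exact: poweR_ge0.
- rewrite unlock -poweRrM.
  have -> : (q^-1 * r = r - 1)%R by rewrite /q invf_div mulfVK// gt_eqF.
  rewrite -poweR_EFin; apply: poweR_le; first by rewrite subr_ge0.
  + by apply: integral_ge0 => t _; exact: poweR_ge0.
  + apply: le_trans nC; apply: ge0_le_integral => //=.
    * apply/measurable_EFinP; apply: (measurableT_comp (measurable_powR _)).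
      exact: measurableT_comp.
    * exact/measurable_EFinP.
    * move=> t _; rewrite lee_fin ger0_norm ?powR_ge0// /f2 -powRrM mulVf ?gt_eqF//.
      by rewrite powRr1.
- rewrite le_eqVlt; apply/orP; left; apply/eqP; apply: eq_integral => t _.
  rewrite /= ger0_norm// /f1 powRM ?powR_ge0// -powRrM mulVf ?gt_eqF//.
  by rewrite powRr1.
Qed.

(** The bound on the mass in k enters through [integralM_powR_le] and yields the
    power [r - 1] of C; after Tonelli's theorem the bound on the mass in v yields
    the last factor C. *)
Lemma schur_test (m : {sigma_finite_measure set T -> \bar R})
    (g rho : T -> R) (N : T * T -> R) (r C : R) :
  (1 <= r)%R -> (0 <= C)%R ->
  measurable_fun setT g -> measurable_fun setT rho -> measurable_fun setT N ->
  (forall t, 0 <= g t)%R -> (forall t, 0 <= rho t)%R -> (forall z, 0 <= N z)%R ->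
  (forall v, \int[m]_k (N (v, k) * rho k)%:E <= C%:E) ->
  (forall k, \int[m]_v (N (v, k) * rho v)%:E <= C%:E) ->
  \int[m]_v ((\int[m]_k (g k * (N (v, k) * rho k))%:E) `^ r * (rho v)%:E) <=
  (C `^ r)%:E * \int[m]_k (g k `^ r * rho k)%:E.
Proof.
move=> r1 C0 mg mrho mN g0 rho0 N0 Nk Nv.
have mNv v : measurable_fun setT (fun k => N (v, k)).
  exact: (measurableT_comp mN (pair1_measurable v)).
have mNk k : measurable_fun setT (fun v => N (v, k)).
  exact: (measurableT_comp mN (pair2_measurable k)).
have mgr : measurable_fun setT (fun k => g k `^ r)%R.
  exact: (measurableT_comp (measurable_powR _)).
pose F (z : T * T) := (g z.2 `^ r * (N z * rho z.2) * rho z.1)%:E.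
have mF : measurable_fun setT F.
  apply/measurable_EFinP; apply: measurable_funM.
    apply: measurable_funM.
      exact: (measurableT_comp mgr measurable_snd).
    by apply: measurable_funM => //; exact: (measurableT_comp mrho measurable_snd).
  exact: (measurableT_comp mrho measurable_fst).
have F0 z : 0 <= F z by rewrite lee_fin !mulr_ge0 ?powR_ge0.
have mA : measurable_fun setT (fun v => \int[m]_k (g k * (N (v, k) * rho k))%:E).
  apply: (measurable_fun_fubini_tonelli_F (fun z => (g z.2 * (N z * rho z.2))%:E)).
    apply/measurable_EFinP; apply: measurable_funM.
      exact: (measurableT_comp mg measurable_snd).
    by apply: measurable_funM => //; exact: (measurableT_comp mrho measurable_snd).
  by move=> z; rewrite lee_fin !mulr_ge0.
have step1 : \int[m]_v ((\int[m]_k (g k * (N (v, k) * rho k))%:E) `^ r * (rho v)%:E) <=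
    \int[m]_v ((C `^ (r - 1))%:E * \int[m]_k F (v, k)).
  apply: ge0_le_integral => //.
  - by move=> v _; rewrite mule_ge0 ?poweR_ge0// lee_fin.
  - apply: emeasurable_funM; last exact/measurable_EFinP.
    exact: (measurableT_comp (measurable_poweR _)).
  - apply: emeasurable_funM => //.
    exact: (measurable_fun_fubini_tonelli_F F).
  - move=> v _; rewrite /F /=.
    under [X in _ <= _ * X]eq_integral do rewrite EFinM.
    rewrite ge0_integralZr//.
    + rewrite muleA lee_wpmul2r ?lee_fin//; apply: integralM_powR_le => //.
      * exact: measurable_funM.
      * by move=> t; rewrite mulr_ge0.
    + apply/measurable_EFinP; apply: measurable_funM => //.
      exact: measurable_funM.
    + by move=> k _; rewrite lee_fin !mulr_ge0 ?powR_ge0.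
    + by rewrite lee_fin.
apply: le_trans step1 _.
rewrite ge0_integralZl//; last 3 first.
- exact: (measurable_fun_fubini_tonelli_F F).
- by move=> v _; exact: integral_ge0.
- by rewrite lee_fin powR_ge0.
rewrite fubini_tonelli//.
have -> : (C `^ r = C `^ (r - 1) * C)%R.
  have [->|C_neq0] := eqVneq C 0%R.
    by rewrite mulr0 powR0// gt_eqF// (lt_le_trans _ r1).
  rewrite -[X in (_ * X)%R]powRr1// -powRD ?C_neq0 ?implybT//.
  by rewrite subrK.
rewrite EFinM -muleA lee_wpmul2l ?lee_fin ?powR_ge0//.
rewrite -ge0_integralZl//; last 2 first.
- by apply/measurable_EFinP; exact: measurable_funM.
- by move=> k _; rewrite lee_fin mulr_ge0 ?powR_ge0.
apply: ge0_le_integral => //.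
- by move=> k _; exact: integral_ge0.
- exact: (measurable_fun_fubini_tonelli_G F).
- by apply: emeasurable_funM => //; apply/measurable_EFinP; exact: measurable_funM.
move=> k _; rewrite /F /=.
under eq_integral => v _.
  rewrite (_ : (g k `^ r * (N (v, k) * rho k) * rho v =
    (g k `^ r * rho k) * (N (v, k) * rho v))%R); last by ring.
  rewrite EFinM; over.
rewrite ge0_integralZl//.
- by rewrite muleC lee_wpmul2r// lee_fin mulr_ge0 ?powR_ge0.
- by apply/measurable_EFinP; exact: measurable_funM.
- by move=> v _; rewrite lee_fin mulr_ge0.
- by rewrite lee_fin mulr_ge0 ?powR_ge0.
Qed.

End Schur.

(** * Integrals of complex functions *)

Section ComplexIntegral.
Variable R : realType.
Local Open Scope complex_scope.

Lemma cmod_ge0 (z : R[i]) : 0 <= cmod z.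
Proof. by case: z => x y; exact: sqrtr_ge0. Qed.

(** Cauchy-Schwarz in the plane. *)
Lemma rotation_le_cmod (c s : R) (z : R[i]) : c ^+ 2 + s ^+ 2 = 1 ->
  c * complex.Re z + s * complex.Im z <= cmod z.
Proof.
case: z => x y /= cs1; apply: le_trans (ler_norm _) _; rewrite -sqrtr_sqr.
apply: ler_wsqrtr; rewrite -[leRHS]mul1r -cs1 -subr_ge0.
by rewrite (_ : _ - _ = (c * y - s * x) ^+ 2) ?sqr_ge0//; ring.
Qed.

Lemma normr_Re_le_cmod (z : R[i]) : `|complex.Re z| <= cmod z.
Proof.
case: z => x y /=; rewrite -sqrtr_sqr ler_wsqrtr// lerDl sqr_ge0//.
Qed.

Lemma normr_Im_le_cmod (z : R[i]) : `|complex.Im z| <= cmod z.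
Proof.
case: z => x y /=; rewrite -sqrtr_sqr ler_wsqrtr// lerDr sqr_ge0//.
Qed.

Lemma cmod_real (x : R) : cmod x%:C = `|x|.
Proof. by rewrite /cmod /= expr0n addr0 sqrtr_sqr. Qed.

Lemma cmod_expi (t : R) : cmod (expi t) = 1.
Proof. by rewrite /cmod /= cos2Dsin2 sqrtr1. Qed.

Lemma cmodM (y z : R[i]) : cmod (y * z) = cmod y * cmod z.
Proof. exact: ComplexField.Normc.normcM. Qed.

(** [cmeasurable] for an arbitrary domain: the integrand of the translation has to
    be measurable on the plane. *)
Definition measurable_complex d (T : measurableType d) (F : T -> R[i]) :=
  measurable_fun setT (fun t => complex.Re (F t)) /\
  measurable_fun setT (fun t => complex.Im (F t)).

Section Measurable.
Context d (T : measurableType d).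
Implicit Types (F G : T -> R[i]) (h : T -> R).

Lemma measurable_complexM F G : measurable_complex F -> measurable_complex G ->
  measurable_complex (fun t => F t * G t).
Proof.
move=> [mF1 mF2] [mG1 mG2]; split.
  rewrite (_ : (fun t => _) = (fun t => complex.Re (F t) * complex.Re (G t) -
      complex.Im (F t) * complex.Im (G t))).
    by apply: measurable_funB; exact: measurable_funM.
  by apply/funext => t; case: (F t) (G t) => [? ?] [].
rewrite (_ : (fun t => _) = (fun t => complex.Re (F t) * complex.Im (G t) +
    complex.Im (F t) * complex.Re (G t))).
  by apply: measurable_funD; exact: measurable_funM.
by apply/funext => t; case: (F t) (G t) => [? ?] [].
Qed.

Lemma measurable_complex_real h : measurable_fun setT h ->
  measurable_complex (fun t => (h t)%:C).
Proof. by []. Qed.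

Lemma measurable_complex_expi h : measurable_fun setT h ->
  measurable_complex (fun t => expi (h t)).
Proof.
move=> mh; split; apply: measurableT_comp mh; apply: continuous_measurable_fun.
  exact: continuous_cos.
exact: continuous_sin.
Qed.

Lemma measurable_cmod F : measurable_complex F ->
  measurable_fun setT (fun t => cmod (F t)).
Proof.
move=> [mR mI].
rewrite (_ : (fun t => _) = (fun t =>
    Num.sqrt (complex.Re (F t) ^+ 2 + complex.Im (F t) ^+ 2))).
  apply: measurableT_comp; last by apply: measurable_funD; exact: measurable_funX.
  by apply: continuous_measurable_fun; exact: sqrt_continuous.
by apply/funext => t; case: (F t).
Qed.

End Measurable.

Lemma cintegrable_le (F : R -> R[i]) (g : R -> R) :
  cmeasurable F -> measurable_fun [set: lebesgueR R] g ->
  (forall k, cmod (F k) <= g k) ->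
  (\int[@leb R]_k (g k)%:E < +oo)%E -> cintegrable F.
Proof.
move=> [mR mI] mg Fg goo.
have g0 k : 0 <= g k by exact: le_trans (cmod_ge0 _) (Fg k).
have ig : (@leb R).-integrable [set: lebesgueR R] (EFin \o g).
  apply/integrableP; split; first exact/measurable_EFinP.
  by under eq_integral do rewrite /= ger0_norm//.
split; apply: le_integrable ig => //; try exact/measurable_EFinP.
- by move=> k _; rewrite /= lee_fin (ger0_norm (g0 k)) (le_trans (normr_Re_le_cmod _)).
- by move=> k _; rewrite /= lee_fin (ger0_norm (g0 k)) (le_trans (normr_Im_le_cmod _)).
Qed.

(** The modulus of the integral is its real part after a rotation onto the
    positive real axis, and the rotation commutes with the integral.  If the
    right-hand side is infinite, whatever default value the left-hand integral
    has is bounded by it. *)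
Lemma cmod_cintegral_le (F : R -> R[i]) (g : R -> R) :
  cmeasurable F -> measurable_fun [set: lebesgueR R] g ->
  (forall k, cmod (F k) <= g k) ->
  ((cmod (cintegral F))%:E <= \int[@leb R]_k (g k)%:E)%E.
Proof.
move=> mF mg Fg.
have g0 k : 0 <= g k by exact: le_trans (cmod_ge0 _) (Fg k).
have : (0 <= \int[@leb R]_k (g k)%:E)%E by apply: integral_ge0 => k _; rewrite lee_fin.
have [goo _|] := ltP (\int[@leb R]_k (g k)%:E)%E +oo%E; last first.
  by rewrite leye_eq => /eqP -> _; rewrite leey.
have [iR iI] := cintegrable_le mF mg Fg goo.
have ig : (@leb R).-integrable [set: lebesgueR R] (EFin \o g).
  apply/integrableP; split; first exact/measurable_EFinP.
  by under eq_integral do rewrite /= ger0_norm//.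
rewrite -(fineK (integrable_fin_num _ ig))// lee_fin -/(Rintegral _ _ _).
set z := cintegral F; have [z0|z0] := eqVneq (cmod z) 0.
  by rewrite z0 Rintegral_ge0.
(* (c, s) is the direction of z, the inverse of the required rotation. *)
pose c := complex.Re z / cmod z; pose s := complex.Im z / cmod z.
have zE : cmod z ^+ 2 = complex.Re z ^+ 2 + complex.Im z ^+ 2.
  by move: (z) => [x y]; rewrite /cmod /= sqr_sqrtr// addr_ge0 ?sqr_ge0.
have cs1 : c ^+ 2 + s ^+ 2 = 1.
  by rewrite /c /s !exprMn -mulrDl -zE -exprMn divff// expr1n.
have -> : cmod z = c * complex.Re z + s * complex.Im z.
  by apply: (mulIf z0); rewrite -expr2 zE /c /s mulrDl; field.
rewrite /z /cintegral /= -!RintegralZl//.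
have icR : (@leb R).-integrable [set: lebesgueR R]
    (EFin \o (fun k => c * complex.Re (F k))) by exact: (integrableZl _ c iR).
have isI : (@leb R).-integrable [set: lebesgueR R]
    (EFin \o (fun k => s * complex.Im (F k))) by exact: (integrableZl _ s iI).
rewrite -RintegralD//; apply: le_Rintegral => //.
  exact: (integrableD _ icR isI).
by move=> k _; exact: le_trans (rotation_le_cmod _ cs1) (Fg k).
Qed.

End ComplexIntegral.

Lemma measurable_Rintegral d1 d2 (T1 : measurableType d1) (T2 : measurableType d2)
    (R : realType) (m : {sigma_finite_measure set T2 -> \bar R})
    (F : T1 * T2 -> R) : measurable_fun setT F ->
  measurable_fun setT (fun v => \int[m]_k F (v, k)).
Proof.
move=> mF; rewrite /Rintegral; apply: (measurableT_comp (fine_measurable measurableT)).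
have mFe : measurable_fun setT (EFin \o F) by exact/measurable_EFinP.
have -> : (fun v => \int[m]_k (F (v, k))%:E)%E =
    (fubini_F m ((EFin \o F)^\+)%E \- fubini_F m ((EFin \o F)^\-)%E)%E.
  apply/funext => v; rewrite integralE /fubini_F.
  by congr (_ - _)%E; apply: eq_integral => k _; rewrite ?funeposE ?funenegE.
apply: emeasurable_funB; apply: measurable_fun_fubini_tonelli_F => //.
  exact: measurable_funepos.
exact: measurable_funeneg.
Qed.

(** * A positive symmetric majorant of the translation *)

Section Translation.
Variable R : realType.
Local Notation lam := (@lebesgue_measure R).
Local Open Scope complex_scope.
Implicit Types (a b d mu w v k : R) (f : R -> R[i]).

(** Law of cosines: up to sign, [sigma x y z] is the cosine of the angle between
    the sides [`|x|] and [`|y|]. *)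
Lemma sigma_le1 (x y z : R) : x != 0 -> y != 0 ->
  `| `|x| - `|y| | < `|z| -> `|z| < `|x| + `|y| -> `|sigma x y z| <= 1.
Proof.
move=> x0 y0 xyz zxy; rewrite /sigma normrM normfV ler_pdivrMr; last first.
  by rewrite normr_gt0 !mulf_neq0.
rewrite mul1r !normrM (@ger0_norm _ 2)//.
have sq (t : R) : t ^+ 2 = `|t| ^+ 2 by rewrite -normrX ger0_norm ?sqr_ge0.
rewrite (sq x) (sq y) (sq z).
move: xyz zxy; move: `|x| `|y| `|z| (normr_ge0 x) (normr_ge0 y) (normr_ge0 z).
move=> {sq x0 y0} X Y Z X0 Y0 Z0; rewrite ltr_norml => /andP[? ?] ?.
by rewrite ler_norml; apply/andP; split; nra.
Qed.

(** Three cosines and 1 add up to at most 4, half of which is 2. *)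
Lemma normr_dunkl_kernel_le mu w v k :
  `|dunkl_kernel mu w v k| <= 2 * bessel_kernel mu `|w| `|v| `|k|.
Proof.
rewrite /dunkl_kernel normrM [X in _ * X]ger0_norm ?bessel_kernel_ge0//.
have [tri|/negbTE tri] := boolP (`| `|w| - `|v| | < `|k| < `|w| + `|v|); last first.
  by rewrite /bessel_kernel tri !mulr0.
apply: ler_wpM2r; first exact: bessel_kernel_ge0.
have [wvk kwv] := andP tri.
have k0 : 0 < `|k| by exact: le_lt_trans wvk.
have [wkv vwk] : `| `|k| - `|w| | < `|v| /\ `|v| < `|k| + `|w|.
  by move: tri; rewrite triangle_swap distrC [`|w| + _]addrC => /andP.
have [vkw wkv'] : `| `|k| - `|v| | < `|w| /\ `|w| < `|k| + `|v|.
  move: tri; rewrite distrC [`|w| + _]addrC triangle_swap distrC.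
  by rewrite [`|v| + _]addrC => /andP.
have w0 : w != 0 by rewrite -normr_gt0; exact: le_lt_trans vkw.
have v0 : v != 0 by rewrite -normr_gt0; exact: le_lt_trans wkv.
have kn0 : k != 0 by rewrite -normr_gt0.
move: (sigma_le1 w0 v0 wvk kwv) (sigma_le1 kn0 w0 wkv vwk) (sigma_le1 kn0 v0 vkw wkv').
rewrite !ler_norml => /andP[? ?] /andP[? ?] /andP[? ?].
by apply/andP; split; lra.
Qed.

Section MeasurableKernel.
Context disp (T : measurableType disp).
Variables (x y z : T -> R).
Hypotheses (mx : measurable_fun setT x) (my : measurable_fun setT y)
  (mz : measurable_fun setT z).

Lemma measurable_sigma : measurable_fun setT (fun t => sigma (x t) (y t) (z t)).
Proof.
rewrite /sigma; apply: measurable_funM.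
  by apply: measurable_funB; [apply: measurable_funD|]; exact: measurable_funX.
by apply: measurable_funV; do 2 apply: measurable_funM => //.
Qed.

End MeasurableKernel.

Lemma measurable_dunkl_kernel mu disp (T : measurableType disp) (x y z : T -> R) :
  measurable_fun setT x -> measurable_fun setT y -> measurable_fun setT z ->
  measurable_fun setT (fun t => dunkl_kernel mu (x t) (y t) (z t)).
Proof.
move=> mx my mz; rewrite /dunkl_kernel; apply: measurable_funM.
  apply: measurable_funM => //; apply: measurable_funD; last exact: measurable_sigma.
  apply: measurable_funD; last exact: measurable_sigma.
  by apply: measurable_funB => //; exact: measurable_sigma.
by apply: measurable_bessel_kernel; exact: measurableT_comp.
Qed.

Definition majorant mu w (z : lebesgueR R * lebesgueR R) : R :=
  2 * bessel_kernel mu `|w| `|z.1 : R| `|z.2 : R|.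

Definition weight mu (k : lebesgueR R) : R := `|k : R| `^ (2 * mu + 1).

Lemma majorant_ge0 mu w z : 0 <= majorant mu w z.
Proof. by rewrite mulr_ge0 ?bessel_kernel_ge0. Qed.

Lemma weight_ge0 mu k : 0 <= weight mu k.
Proof. exact: powR_ge0. Qed.

Lemma majorant_weight_ge0 mu w z k : 0 <= majorant mu w z * weight mu k.
Proof. by apply: mulr_ge0; [exact: majorant_ge0|exact: weight_ge0]. Qed.

Lemma majorant_swap mu w v k : majorant mu w (v, k) = majorant mu w (k, v).
Proof. by rewrite /majorant /= bessel_kernel_swap. Qed.

Lemma measurable_fst_leb :
  measurable_fun setT
    ((fun z => z.1) : lebesgueR R * lebesgueR R -> measurableTypeR R).
Proof.
exact: (measurableT_comp (@measurable_borel_of_lebesgue R) measurable_fst).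
Qed.

Lemma measurable_snd_leb :
  measurable_fun setT
    ((fun z => z.2) : lebesgueR R * lebesgueR R -> measurableTypeR R).
Proof.
exact: (measurableT_comp (@measurable_borel_of_lebesgue R) measurable_snd).
Qed.

Lemma measurable_majorant mu w : measurable_fun setT (majorant mu w).
Proof.
apply: measurable_funM => //; apply: measurable_bessel_kernel => //.
  exact: (measurableT_comp (@normr_measurable R setT) measurable_fst_leb).
exact: (measurableT_comp (@normr_measurable R setT) measurable_snd_leb).
Qed.

Lemma measurable_weight mu : measurable_fun setT (weight mu).
Proof.
apply: (measurableT_comp (measurable_powR _)).
exact: (measurableT_comp (@normr_measurable R setT) (@measurable_borel_of_lebesgue R)).
Qed.

(** The value 4 is 2, the bound on the bracket of the Dunkl kernel, times 2, for
    the two half-lines.  At [v = 0] the triangles degenerate and the kernel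
    vanishes. *)
Lemma majorant_mass mu w v : 0 < w ->
  (\int[@leb R]_k (majorant mu w (v, k) * weight mu k)%:E <= 4%:E)%E.
Proof.
move=> w0; have [->|v0] := eqVneq (v : R) 0.
  rewrite integral0_eq ?lee_fin// => k _; rewrite /majorant /= normr0.
  by rewrite bessel_kernel_swap bessel_kernel_le0// mulr0 mul0r.
pose h (k : R) : R := bessel_kernel mu `|w| `|v : R| `|k| * `|k| `^ (2 * mu + 1).
have h0 k : 0 <= h k by rewrite mulr_ge0 ?bessel_kernel_ge0 ?powR_ge0.
have mh : measurable_fun [set: R] h.
  apply: measurable_funM; last by apply: (measurableT_comp (measurable_powR _)).
  by apply: measurable_bessel_kernel => //; exact: measurable_cst.
have -> : (\int[@leb R]_k (majorant mu w (v, k) * weight mu k)%:E =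
    \int[@leb R]_k (2 * h k)%:E)%E.
  by apply: eq_integral => k _; rewrite /h mulrA.
rewrite (@ge0_integral_leb _ (fun k => (2 * h k)%:E)); first last.
- by move=> k; rewrite lee_fin mulr_ge0.
- by apply/measurable_EFinP; exact: measurable_funM.
under eq_integral do rewrite EFinM.
rewrite ge0_integralZl//; first last.
- by move=> k _; rewrite lee_fin.
- exact/measurable_EFinP.
rewrite (_ : 4%:E = 2%:E * 2%:E)%E; last by rewrite -EFinM -natrM.
by apply: lee_wpmul2l => //; apply: bessel_kernel_mass_abs; rewrite normr_gt0// gt_eqF.
Qed.

Lemma majorant_mass_swap mu w k : 0 < w ->
  (\int[@leb R]_v (majorant mu w (v, k) * weight mu v)%:E <= 4%:E)%E.
Proof.
move=> w0; under eq_integral do rewrite majorant_swap.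
exact: majorant_mass.
Qed.

Lemma cmod_qpd_integrand_le a b d mu w f v k :
  cmod (qpd_integrand a b d mu w f v k) <=
  cmod (f k) * (majorant mu w (v, k) * weight mu k).
Proof.
rewrite /qpd_integrand /qpd_kernel !cmodM !cmod_expi !cmod_real !mulr1 -mulrA.
rewrite ler_wpM2l ?cmod_ge0// [X in _ * X]ger0_norm ?powR_ge0//.
by rewrite ler_wpM2r ?powR_ge0// normr_dunkl_kernel_le.
Qed.

Lemma measurable_qpd_integrand a b d mu w f : cmeasurable f ->
  measurable_complex (fun z : lebesgueR R * lebesgueR R =>
    qpd_integrand a b d mu w f z.1 z.2).
Proof.
move=> [mfR mfI].
have m1 := measurable_fst_leb; have m2 := measurable_snd_leb.
pose x (z : lebesgueR R * lebesgueR R) : R := z.1.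
pose y (z : lebesgueR R * lebesgueR R) : R := z.2.
have mx : measurable_fun setT x by [].
have my : measurable_fun setT y by [].
have mf : measurable_complex (fun z => f (y z)).
  split; first exact: (measurableT_comp mfR measurable_snd).
  exact: (measurableT_comp mfI measurable_snd).
have mk : measurable_complex (fun z => qpd_kernel a b d mu w (x z) (y z)).
  apply: measurable_complexM.
    by apply: measurable_complex_real; apply: measurable_dunkl_kernel.
  apply: measurable_complex_expi; apply: measurable_funN.
  apply: measurable_funD; apply: measurable_funM => //; apply: measurable_funD => //.
  - by apply: measurable_funD => //; exact: measurable_funX.
  - exact: measurable_funX.
  - exact: measurable_funD.
have me : measurable_complex (fun z => expi (a * y z ^+ 2 + d * y z)).
  apply: measurable_complex_expi; apply: measurable_funD; apply: measurable_funM => //.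
  exact: measurable_funX.
have mr : measurable_complex (fun z => (`|y z| `^ (2 * mu + 1))%:C).
  apply: measurable_complex_real; apply: (measurableT_comp (measurable_powR _)).
  exact: (measurableT_comp (@normr_measurable R setT) my).
exact: measurable_complexM (measurable_complexM (measurable_complexM mf mk) me) mr.
Qed.

Lemma measurable_complex_slice (F : lebesgueR R * lebesgueR R -> R[i]) v :
  measurable_complex F -> cmeasurable (fun k => F (v, k)).
Proof.
move=> [mR mI]; split.
  exact: (measurableT_comp mR (pair1_measurable (v : lebesgueR R))).
exact: (measurableT_comp mI (pair1_measurable (v : lebesgueR R))).
Qed.

Lemma cmeasurable_qpd_translation a b d mu w f : cmeasurable f ->
  cmeasurable (qpd_translation a b d mu w f).
Proof.
move=> mf; rewrite /qpd_translation; case: (w == 0); first exact: mf.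
have [mR mI] := measurable_qpd_integrand a b d mu w mf.
split; first exact: (measurable_Rintegral (@leb R) mR).
exact: (measurable_Rintegral (@leb R) mI).
Qed.

(** The positive operator with kernel [majorant], applied to the modulus of f.  Its
    finiteness at v is what makes the translation converge there. *)
Definition majorant_integral mu w f (v : lebesgueR R) : \bar R :=
  (\int[@leb R]_k (cmod (f k) * (majorant mu w (v, k) * weight mu k))%:E)%E.

Lemma measurable_majorant_integrand mu w f (v : lebesgueR R) : cmeasurable f ->
  measurable_fun [set: lebesgueR R]
    (fun k => cmod (f k) * (majorant mu w (v, k) * weight mu k)).
Proof.
move=> mf; apply: measurable_funM; first exact: measurable_cmod.
apply: measurable_funM; last exact: measurable_weight.
exact: (measurableT_comp (measurable_majorant mu w) (pair1_measurable v)).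
Qed.

Lemma measurable_majorant_integral mu w f : cmeasurable f ->
  measurable_fun [set: lebesgueR R] (majorant_integral mu w f).
Proof.
move=> mf; have mfc := measurable_cmod mf.
pose F (z : lebesgueR R * lebesgueR R) :=
  (cmod (f z.2) * (majorant mu w z * weight mu z.2))%:E.
have mF : measurable_fun setT F.
  apply/measurable_EFinP; apply: measurable_funM.
    exact: (measurableT_comp mfc measurable_snd).
  apply: measurable_funM; first exact: measurable_majorant.
  exact: (measurableT_comp (measurable_weight mu) measurable_snd).
have F0 z : (0 <= F z)%E.
  by rewrite lee_fin mulr_ge0 ?cmod_ge0 ?majorant_weight_ge0.
exact: (@measurable_fun_fubini_tonelli_F _ _ _ _ R (@leb R) F mF F0).
Qed.

Lemma cintegrable_qpd_integrand a b d mu w f v : cmeasurable f ->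
  (majorant_integral mu w f v < +oo)%E ->
  cintegrable (qpd_integrand a b d mu w f v).
Proof.
move=> mf; apply: cintegrable_le.
- exact: measurable_complex_slice v (measurable_qpd_integrand a b d mu w mf).
- exact: measurable_majorant_integrand.
- by move=> k; exact: cmod_qpd_integrand_le.
Qed.

Lemma cmod_qpd_translation_le a b d mu w f v : w != 0 -> cmeasurable f ->
  ((cmod (qpd_translation a b d mu w f v))%:E <= majorant_integral mu w f v)%E.
Proof.
move=> w0 mf; rewrite /qpd_translation (negbTE w0); apply: cmod_cintegral_le.
- exact: measurable_complex_slice v (measurable_qpd_integrand a b d mu w mf).
- exact: measurable_majorant_integrand.
- by move=> k; exact: cmod_qpd_integrand_le.
Qed.

End Translation.

(** * Norm bounds *)

Section Bounds.
Variable R : realType.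
Implicit Types (a b d mu w v : R) (f : R -> R[i]).
Local Open Scope ereal_scope.

Lemma leb_setT_gt0 : 0 < @leb R [set: lebesgueR R].
Proof.
have -> : @leb R [set: lebesgueR R] = @lebesgue_measure R [set: R] by [].
rewrite (_ : [set: R] = [set` `]-oo, +oo[%R]); last by rewrite set_itvE.
by rewrite (@lebesgue_measure_itv R `]-oo, +oo[%R) /= ltry.
Qed.

Lemma ae_leb_mono (P Q : lebesgueR R -> Prop) : (forall v, P v -> Q v) ->
  (\forall v \ae @leb R, P v) -> \forall v \ae @leb R, Q v.
Proof. exact: (@filterS _ _ (ae_filter_ringOfSetsType (@leb R))). Qed.

Lemma normLp_ge0 mu p f : 1 <= p -> 0 <= normLp mu p f.
Proof.
case: p => [r| |]//= _; first exact: poweR_ge0.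
apply: ess_sup_gee; first exact: leb_setT_gt0.
by apply: aeW => v; rewrite lee_fin cmod_ge0.
Qed.

Lemma majorant_integral_Lr mu w f (r : R) : (0 < w)%R -> (1 <= r)%R -> cmeasurable f ->
  \int[@leb R]_v (majorant_integral mu w f v `^ r * (weight mu v)%:E) <=
  (4 `^ r)%:E * \int[@leb R]_v (cmod (f v) `^ r * weight mu v)%:E.
Proof.
move=> w0 r1 mf; apply: schur_test => //.
- exact: measurable_cmod.
- exact: measurable_weight.
- exact: measurable_majorant.
- by move=> t; exact: cmod_ge0.
- by move=> t; exact: weight_ge0.
- by move=> z; exact: majorant_ge0.
- by move=> v; exact: majorant_mass.
- by move=> v; exact: majorant_mass_swap.
Qed.

(** Here the bound holds at every point: only the mass in k is integrated
    against the essential supremum. *)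
Lemma majorant_integral_Loo mu w f v : (0 < w)%R -> cmeasurable f ->
  normLp mu +oo f < +oo ->
  majorant_integral mu w f v <= 4%:E * normLp mu +oo f.
Proof.
move=> w0 mf; have := @normLp_ge0 mu +oo f (leey _); rewrite /=.
set M := ess_sup _ _; have fM : \forall k \ae @leb R, (cmod (f k))%:E <= M.
  exact: ess_sup_ge.
case: M fM => [m| |]//= fM; rewrite lee_fin => m0 _.
have mN : measurable_fun [set: lebesgueR R]
    (fun k => majorant mu w (v, k) * weight mu k)%R.
  apply: measurable_funM; last exact: measurable_weight.
  apply: (measurableT_comp (measurable_majorant mu w)).
  exact: (pair1_measurable (v : lebesgueR R)).
apply: (@le_trans _ _ (\int[@leb R]_k (m * (majorant mu w (v, k) * weight mu k))%:E)).
  apply: ae_ge0_le_integral => //.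
  - by move=> k _; rewrite lee_fin mulr_ge0 ?cmod_ge0 ?majorant_weight_ge0.
  - by apply/measurable_EFinP; exact: measurable_majorant_integrand.
  - by move=> k _; rewrite lee_fin mulr_ge0 ?majorant_weight_ge0.
  - by apply/measurable_EFinP; exact: measurable_funM.
  - apply: ae_leb_mono fM => k; rewrite lee_fin => fkm _.
    by rewrite lee_fin ler_wpM2r// majorant_weight_ge0.
under eq_integral do rewrite EFinM.
rewrite ge0_integralZl//; first last.
- by move=> k _; rewrite lee_fin majorant_weight_ge0.
- exact/measurable_EFinP.
by rewrite muleC; apply: lee_wpmul2r => //; exact: majorant_mass.
Qed.

End Bounds.

Theorem proposition4p5 (R : realType) (a b d mu : R)
    (hb : b != 0) (hmu : - (1 / 2) < mu)
    (p : \bar R) (hp : (1 <= p)%E)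
    (f : R -> R[i]) (hf : inLp mu p f)
    (w : R) (hw : 0 <= w) :
  qpd_translation_defined a b d mu w f /\
  inLp mu p (qpd_translation a b d mu w f) /\
  (normLp mu p (qpd_translation a b d mu w f) <= 4%:E * normLp mu p f)%E.
Proof.
have [mf foo] := hf; have n0 := normLp_ge0 mu f hp.
have mt := cmeasurable_qpd_translation a b d mu w mf.
suff [dfn bnd] : qpd_translation_defined a b d mu w f /\
    (normLp mu p (qpd_translation a b d mu w f) <= 4%:E * normLp mu p f)%E.
  split=> //; split => //; split => //; apply: le_lt_trans bnd _.
  by rewrite lte_mul_pinfty// ge0_fin_numE.
have [->|w_neq0] := eqVneq w 0.
  split; first by move=> /eqP.
  rewrite /qpd_translation eqxx -[leLHS]mul1e; apply: lee_wpmul2r => //.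
  by rewrite lee_fin ler1n.
have w0 : 0 < w by rewrite lt_neqAle eq_sym w_neq0.
have tM v := cmod_qpd_translation_le a b d mu v w_neq0 mf.
case: p hp hf foo n0 => [r| |]// hp hf foo n0; last first.
  have Aoo v := majorant_integral_Loo v w0 mf foo.
  split.
    move=> _; apply/aeW => v; apply: cintegrable_qpd_integrand => //.
    by apply: le_lt_trans (Aoo v) _; rewrite lte_mul_pinfty// ge0_fin_numE.
  by apply/ess_supP/aeW => v; exact: le_trans (tM v) (Aoo v).
have r1 : 1 <= r by rewrite -lee_fin.
have r0 : 0 < r by exact: lt_le_trans r1.
have schur := majorant_integral_Lr mu w0 r1 mf.
have mA := measurable_majorant_integral mu w mf.
set X := (\int[@leb R]_v (cmod (f v) `^ r * weight mu v)%:E)%E in schur.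
have X0 : (0 <= X)%E.
  by apply: integral_ge0 => v _; rewrite lee_fin mulr_ge0 ?powR_ge0 ?weight_ge0.
have Xoo : (X < +oo)%E by move: foo; apply: lty_poweRy; rewrite invr_eq0 gt_eqF.
have mAr : measurable_fun [set: lebesgueR R]
    (fun v => majorant_integral mu w f v `^ r * (weight mu v)%:E)%E.
  apply: emeasurable_funM; first exact: (measurableT_comp (measurable_poweR _)).
  by apply/measurable_EFinP; exact: measurable_weight.
split.
  move=> _.
  have /integrable_ae : (@leb R).-integrable [set: lebesgueR R]
      (fun v => majorant_integral mu w f v `^ r * (weight mu v)%:E)%E.
    apply/integrableP; split => //.
    under eq_integral do rewrite gee0_abs ?mule_ge0 ?poweR_ge0 ?lee_fin ?weight_ge0//.
    by apply: le_lt_trans schur _; rewrite lte_mul_pinfty// lee_fin powR_ge0.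
  move=> /(_ measurableT); apply: ae_leb_mono => v /(_ I) Afin.
  apply: cintegrable_qpd_integrand => //.
  (* The weight vanishes at 0, where the kernel vanishes as well; elsewhere a
     finite product with a positive weight has a finite factor. *)
  have [v0|v0] := eqVneq v 0.
    rewrite /majorant_integral integral0_eq// => k _.
    rewrite /majorant /= v0 normr0 bessel_kernel_swap bessel_kernel_le0//.
    by rewrite mulr0 mul0r mulr0.
  rewrite ltey; apply/eqP => Aoo; move: Afin.
  rewrite Aoo poweRyr ?gt_eqF// gt0_mulye//.
  by rewrite lte_fin powR_gt0// normr_gt0.
rewrite /= -/X.
have -> : 4%:E = ((4 `^ r)%:E `^ r^-1 :> \bar R)%E.
  by rewrite poweR_EFin -powRrM mulfV ?gt_eqF// powRr1.
rewrite -poweRM ?lee_fin ?powR_ge0//.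
apply: poweR_le; first by rewrite invr_ge0 ltW.
  by apply: integral_ge0 => v _; rewrite lee_fin mulr_ge0 ?powR_ge0.
apply: le_trans schur; apply: ge0_le_integral => //.
- by move=> v _; rewrite lee_fin mulr_ge0 ?powR_ge0.
- apply/measurable_EFinP; apply: measurable_funM; last exact: measurable_weight.
  by apply: (measurableT_comp (measurable_powR _)); exact: measurable_cmod.
- move=> v _; rewrite EFinM; apply: lee_wpmul2r; first by rewrite lee_fin powR_ge0.
  rewrite -poweR_EFin; apply: poweR_le (tM v); first exact: ltW.
  by rewrite lee_fin cmod_ge0.
Qed.
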